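(* Let $X$ be an infinite compact F-space. Then there exist $a,b\in X$ such that $a$ and $b$ are not pin equivalent in $X$.
   Context: All spaces are assumed to be Hausdorff. A space $X$ is an F-space if every two disjoint open $F_\sigma$-sets have disjoint closures. Points $a,b$ in a compact space $X$ are pin equivalent (in $X$) if there exist a compact space $Y$, a continuous surjection $f\colon Y\to X$, and a homeomorphism $g\colon Y\to Y$ such that $g(f^{-1}\{a\})=f^{-1}\{b\}$. *)

(* Defs.v *)
From HB Require Import structures.
From mathcomp Require Import all_boot all_order all_algebra.
From mathcomp Require Import boolp classical_sets functions cardinality.
From mathcomp Require Import topology borel_hierarchy.

Set Implicit Arguments.
Unset Strict Implicit.
Unset Printing Implicit Defensive.

Local Open Scope classical_set_scope.

Definition F_space (X : topologicalType) : Prop :=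
  forall U V : set X,
    open U -> Fsigma U -> open V -> Fsigma V ->
    U `&` V = set0 -> closure U `&` closure V = set0.

Definition homeomorphism (X Y : topologicalType) (g : X -> Y) : Prop :=
  continuous g /\
  exists h : Y -> X, [/\ cancel g h, cancel h g & continuous h].

(* The Hausdorff condition on Y is the convention that all spaces are
   Hausdorff. *)
Definition pin_equivalent (X : topologicalType) (a b : X) : Prop :=
  exists (Y : topologicalType) (f : Y -> X) (g : Y -> Y),
    [/\ hausdorff_space Y,
        compact [set: Y],
        continuous f /\ set_surj [set: Y] [set: X] f,
        homeomorphism g &
        g @` (f @^-1` [set a]) = f @^-1` [set b]].

(* Main.v *)
(* A pin equivalence of b with a turns every sequence of points different from b
   that accumulates at b along an ultrafilter p on nat into one of points
   different from a that accumulates at a along p. Let b be a limit along p of a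
   discrete sequence d, and a a limit of d along q, where q is an ultrafilter that
   is not an image of p and that has Kunen's OK property, a strong form of being
   a weak P-point. As countable separated sets in X have disjoint closures, points
   x_n that accumulate at a along p must either lie in disjoint neighbourhoods of
   the d_s (then n |-> s maps p to q) or lie in the closure of d but not in d
   (then OK sets and the pigeonhole principle put some x_n in the closure of an
   element of q that was chosen to avoid it).
   The ultrafilter q is built by transfinite recursion over a family of continuum
   many independent rows of linked sets. *)
Require Import Defs.
From HB Require Import structures.
From mathcomp Require Import all_boot all_order all_algebra.
From mathcomp Require Import boolp classical_sets functions cardinality.
From mathcomp Require Import topology borel_hierarchy.
From mathcomp Require Import wochoice.

Set Implicit Arguments.
Unset Strict Implicit.
Unset Printing Implicit Defensive.

Local Open Scope classical_set_scope.

(** * Independent linked families *)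

Definition real := nat -> bool.

Definition restr (k : nat) (Y : real) : {set 'I_k} := finset (fun i : 'I_k => Y i).

(** A node of level [k] is a finite guess: it assigns to each trace of a row on the first [k]
    coordinates a set of traces of columns. Nodes form a countable index set. *)
Notation node := {k : nat & {ffun {set 'I_k} -> {set {set 'I_k}}}}.

Definition mk_node k (f : {ffun {set 'I_k} -> {set {set 'I_k}}}) : node :=
  Tagged (fun k => {ffun {set 'I_k} -> {set {set 'I_k}}}) f.

(* Kunen's independent linked family: the rows [Y] are independent of each other,
   and within row [Y], any [n] of the sets [linked Y X n] meet in an infinite set
   while any [n.+1] of them have a bounded intersection. *)
Definition linked (Y X : real) (n : nat) : set node :=
  [set s : node | (#|tagged s (restr (tag s) Y)| <= n)%N &&
           (restr (tag s) X \in tagged s (restr (tag s) Y))].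

(** Every level is finite, so these are the cofinite sets of nodes. *)
Definition cofinal_nodes : set_system node :=
  [set M | exists k, forall s : node, (k <= tag s)%N -> M s].

(* The level of row [Y] is the number of columns [phi Y] used in that row. *)
Definition config (L : seq real) (phi : real -> seq real) : set node :=
  [set s : node | forall Y, Y \in L -> forall X, X \in phi Y -> linked Y X (size (phi Y)) s].

Lemma restr_inj_on (L : seq real) :
  exists k0, forall k, (k0 <= k)%N -> {in L &, injective (restr k)}.
Proof.
have /choice[K HK] : forall XY : real * real, exists m,
    forall k, (m <= k)%N -> restr k XY.1 = restr k XY.2 -> XY.1 = XY.2.
  move=> [X Y] /=; have [->|/eqP XY] := eqVneq X Y; first by exists 0%N.
  have [m Xm] : exists m, X m <> Y m.
    apply: contrapT => h; apply: XY; apply/funext => m.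
    by apply: contrapT => hm; apply: h; exists m.
  exists m.+1 => k mk /setP /(_ (Ordinal mk)); rewrite !inE //=.
exists (\max_(X <- L) \max_(Y <- L) K (X, Y))%N => k Lk X Y XL YL.
apply: (HK (X, Y)); apply: leq_trans Lk.
have h Z (F : real -> nat) : Z \in L -> (F Z <= \max_(W <- L) F W)%N.
  by move=> ZL; apply: leq_bigmax_seq.
apply: leq_trans (h X (fun X => \max_(Y <- L) K (X, Y))%N XL).
exact: (h Y (fun Y => K (X, Y))).
Qed.

(** At a level where the rows in [L] have distinct traces, a node may assign arbitrary sets to these
    traces, in particular the traces of the columns [phi Y]. *)
Lemma config_unbounded (L : seq real) (phi : real -> seq real) (k0 : nat) :
  exists s, (k0 <= tag s)%N /\ config L phi s.
Proof.
have [k1 /(_ (maxn k0 k1) (leq_maxr _ _))] := restr_inj_on L.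
set k := maxn k0 k1 => inj.
pose f := [ffun Z : {set 'I_k} => finset (fun W : {set 'I_k} =>
  has (fun Y => (restr k Y == Z) && (W \in map (restr k) (phi Y))) L)].
exists (mk_node f); split.
  exact: leq_maxl.
move=> Y YL X Xphi; rewrite /linked /=.
have -> : f (restr k Y) = finset (mem (map (restr k) (phi Y))).
  apply/setP => W; rewrite !ffunE !inE; apply/hasP/idP => [[Z ZL]|WY].
    by move=> /andP[/eqP/inj->].
  by exists Y => //; rewrite eqxx.
apply/andP; split; last by rewrite inE; exact: (map_f (restr k)).
by rewrite cardsE -(size_map (restr k)); exact: card_size.
Qed.

(** At a level where the columns in [L] have distinct traces, these would be [size L] elements of a
    set of cardinality at most [j]. *)
Lemma linked_bounded (Y : real) (L : seq real) : uniq L ->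
  exists k0, forall s j, (j < size L)%N ->
    (forall X, X \in L -> linked Y X j s) -> (tag s < k0)%N.
Proof.
move=> uL; have [k0 inj] := restr_inj_on L; exists k0 => s j jL h.
rewrite ltnNge; apply/negP => /inj{}inj.
have : (size (map (restr (tag s)) L) <= #|tagged s (restr (tag s) Y)|)%N.
  rewrite cardE; apply: uniq_leq_size; first by rewrite map_inj_in_uniq.
  by move=> _ /mapP[X XL ->]; rewrite mem_enum; case/andP: (h _ XL).
have X0 : nth (fun=> true) L 0 \in L by rewrite mem_nth// (leq_ltn_trans _ jL).
have /andP[hj _] := h _ X0.
by rewrite size_map => /leq_trans /(_ hj); rewrite leqNgt jL.
Qed.

Lemma linkedS (Y X : real) (m n : nat) : (m <= n)%N -> linked Y X m `<=` linked Y X n.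
Proof. by move=> mn s /andP[h hX]; apply/andP; split => //; apply: leq_trans mn. Qed.

Lemma cofinal_nodes_filter : Filter cofinal_nodes.
Proof.
split; first by exists 0%N.
- move=> A B [k hA] [l hB]; exists (maxn k l) => s; rewrite geq_max => /andP[? ?].
  by split; [apply: hA|apply: hB].
- by move=> A B AB [k hA]; exists k => s /hA/AB.
Qed.

Lemma finite_small_nodes k : finite_set [set s : node | (tag s < k)%N].
Proof.
apply: (@sub_finite_set _ _ (\bigcup_(j in `I_k)
   range (@mk_node j))).
  by move=> [j f] /= jk; exists j => //; exists f.
by apply: bigcup_finite => // j _; apply: finite_image; exact: finite_finset.
Qed.

(** * One-step extensions of independent filters *)

Definition independent (F : set_system node) (D : set real) :=
  forall M, F M -> forall L phi, (forall Y, Y \in L -> ~ D Y) ->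
    M `&` config L phi !=set0.

Definition adjoin (F : set_system node) (C : set node) : set_system node :=
  [set M | exists2 N, F N & N `&` C `<=` M].

Lemma adjoin_filter F C : Filter F -> Filter (adjoin F C).
Proof.
move=> FF; split; first by exists setT => //; apply: filterT.
- move=> A B [M FM MA] [N FN NB]; exists (M `&` N); first exact: filterI.
  by move=> s [[Ms Ns] Cs]; split; [apply: MA|apply: NB].
- by move=> A B AB [M FM MA]; exists M => // s /MA/AB.
Qed.

Lemma sub_adjoin F C : F `<=` adjoin F C.
Proof. by move=> M FM; exists M => // s []. Qed.

Lemma configU L1 L2 phi1 phi2 : (forall Y, Y \in L1 -> Y \notin L2) ->
  exists phi, config (L1 ++ L2) phi `<=` config L1 phi1 `&` config L2 phi2.
Proof.
move=> L12; exists (fun Y => if Y \in L1 then phi1 Y else phi2 Y) => s h; split.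
  by move=> Y YL; have := h Y; rewrite mem_cat YL; apply.
move=> Y YL; have := h Y; rewrite mem_cat YL orbT; case: ifP; last by move=> _; apply.
by move=> /L12; rewrite YL.
Qed.

(** [D] collects the rows already spent. A configuration on fresh rows and the one adjoined on [L]
    merge into a single configuration that avoids [D]. *)
Lemma adjoin_config_independent F D L phi :
  independent F D -> (forall Y, Y \in L -> ~ D Y) ->
  independent (adjoin F (config L phi)) (D `|` [set` L]).
Proof.
move=> Find LD M [N FN NM] L' phi' L'D.
have [|phi2 hphi2] := @configU L' L phi' phi.
  by move=> Y /L'D h; apply/negP => YL; apply: h; right.
have [|s [Ns /hphi2[s1 s2]]] := Find N FN (L' ++ L) phi2.
  move=> Y; rewrite mem_cat => /orP[/L'D h DY|/LD//]; apply: h; by left.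
by exists s; split => //; apply: NM.
Qed.

(** Kunen's OK condition for [B]: continuum many sets, any [n >= 1] of which have their intersection
    inside [B n] up to finitely many nodes. *)
Definition ok_family (B : nat -> set node) (O : real -> set node) :=
  forall L : seq real, uniq L -> (0 < size L)%N -> exists k0, forall s : node,
    (forall X, X \in L -> O X s) -> ~ B (size L) s -> (tag s < k0)%N.

(* For [B n = [set h n]], this says that [F] is not contained in the image of the
   ultrafilter [p] under [h]. *)
Definition not_image (p : set_system nat) (B : nat -> set node) (F : set_system node) :=
  exists2 M, F M & ~ p [set n | B n !=set0 /\ B n `<=` M].

(** For a constant sequence [B] this puts the set or its complement into [F], so one requirement
    yields both maximality and the OK property. *)
Definition decided (B : nat -> set node) (F : set_system node) :=
  (exists n, F (~` B n)) \/
  (forall n, F (B n)) /\ exists2 O, ok_family B O & forall X, F (O X).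

(** Two columns of a fresh row give sets with bounded intersection. If [p]-almost all [B n] are
    nonempty and inside both, they are not inside a final segment of levels; so one of these three
    sets serves as [M]. *)
Lemma not_image_step p B F D : ProperFilter p -> Filter F -> cofinal_nodes `<=` F ->
  independent F D -> (exists Y, ~ D Y) ->
  exists F' (L : seq real), [/\ Filter F', F `<=` F', independent F' (D `|` [set` L]) &
    not_image p B F'].
Proof.
move=> pp FF cF Find [Y DY].
suff [M hM [phi MC]] : exists2 M, ~ p [set n | B n !=set0 /\ B n `<=` M] &
    exists phi, adjoin F (config [:: Y] phi) M.
  exists (adjoin F (config [:: Y] phi)), [:: Y]; split.
  - exact: adjoin_filter.
  - exact: sub_adjoin.
  - by apply: adjoin_config_independent => // Z; rewrite inE => /eqP ->.
  - by exists M.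
pose X1 : real := fun=> true; pose X2 : real := fun=> false.
have hX X : config [:: Y] (fun=> [:: X]) `<=` linked Y X 1.
  by move=> s /(_ Y); rewrite inE eqxx => /(_ isT X); rewrite inE eqxx; apply.
have X12 : X1 != X2 by apply/eqP => /(congr1 (@^~ 0%N)).
have [k0 hk0] := @linked_bounded Y [:: X1; X2] ltac:(by rewrite /= inE X12).
have [h1|h1] := pselect (p [set n | B n !=set0 /\ B n `<=` linked Y X1 1]); last first.
  exists (linked Y X1 1) => //; exists (fun=> [:: X1]); exists setT; first exact: filterT.
  by move=> s [_]; apply: hX.
have [h2|h2] := pselect (p [set n | B n !=set0 /\ B n `<=` linked Y X2 1]); last first.
  exists (linked Y X2 1) => //; exists (fun=> [:: X2]); exists setT; first exact: filterT.
  by move=> s [_]; apply: hX.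
exists [set s : node | (k0 <= tag s)%N]; last first.
  exists (fun=> [:: X1]); apply: sub_adjoin; apply: cF; by exists k0.
move=> h3; have [n [[[_ b1] [[s Bs] b2]] [_ b3]]] := filter_ex (filterI (filterI h1 h2) h3).
have := b3 _ Bs; rewrite /= leqNgt => /negP; apply.
apply: (hk0 s 1%N) => // X; rewrite !inE => /orP[] /eqP ->; [exact: b1|exact: b2].
Qed.

Lemma decided_step B F D : (forall m n, (m <= n)%N -> B n `<=` B m) ->
  Filter F -> independent F D -> (exists Y, ~ D Y) ->
  exists F' (L : seq real), [/\ Filter F', F `<=` F', independent F' (D `|` [set` L]) &
    decided B F'].
Proof.
move=> Bdec FF Find [Y DY].
(* If a finite configuration within a set of [F] misses some [B n], adjoining it puts the complement
   of [B n] into the filter. Otherwise every [B n] can be added. *)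
have [[n [M [L [phi [FM LD hdis]]]]]|hno] := pselect (exists n M L phi,
    [/\ F M, forall Y, Y \in L -> ~ D Y & ~ (M `&` config L phi `&` B n !=set0)]).
  exists (adjoin F (config L phi)), L; split.
  - exact: adjoin_filter.
  - exact: sub_adjoin.
  - exact: adjoin_config_independent.
  - by left; exists n, M => // s MCs Bs; apply: hdis; exists s.
(* On [B j `\` B j.+1] the set [O X] is [linked Y X j], so that [n] of the [O X]
   have a bounded intersection outside [B n]. *)
pose O X : set node := [set s | B 0%N s /\ forall j, B j s -> ~ B j.+1 s -> linked Y X j s].
have okO : ok_family B O.
  move=> L uL L0; have [k0 hk0] := linked_bounded Y uL; exists k0 => s Os nBs.
  have B0 : B 0%N s by case: (L) L0 Os => // X L' _ /(_ X (mem_head _ _))[].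
  have [j [jL Bj nBj]] : exists j, [/\ (j < size L)%N, B j s & ~ B j.+1 s].
    elim: (size L) nBs => [/(_ B0)//|n IH nBn].
    have [Bn|/IH[j [jn Bj nBj]]] := pselect (B n s); first by exists n.
    by exists j; split => //; exact: leqW.
  by apply: (hk0 s j) => // X /Os[_]; apply.
pose F' : set_system node := [set M | exists N n (L : seq real), F N /\
   [set s | [/\ N s, B n s & forall X, X \in L -> O X s]] `<=` M].
exists F', [:: Y]; split.
- split.
  + by exists setT, 0%N, [::]; split => //; exact: filterT.
  + move=> M1 M2 [N1 [n1 [L1 [F1 h1]]]] [N2 [n2 [L2 [F2 h2]]]].
    exists (N1 `&` N2), (maxn n1 n2), (L1 ++ L2); split; first exact: filterI.
    move=> s [[s1 s2] Bs Os]; split; [apply: h1|apply: h2]; split => //.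
    * by apply: Bdec Bs; exact: leq_maxl.
    * by move=> X XL; apply: Os; rewrite mem_cat XL.
    * by apply: Bdec Bs; exact: leq_maxr.
    * by move=> X XL; apply: Os; rewrite mem_cat XL orbT.
  + by move=> M1 M2 M12 [N [n [L [FN h]]]]; exists N, n, L; split => // s /h/M12.
- by move=> M FM; exists M, 0%N, [::]; split => // s [].
- move=> M [N [n [L [FN hM]]]] L' phi' L'D.
  have [|phi hphi] := @configU L' [:: Y] phi' (fun=> L).
    move=> Z /L'D ZD; apply/negP; rewrite inE => /eqP ZY; apply: ZD; right.
    by rewrite /= ZY inE.
  (* A node of [B m] can leave the sequence [B] only after index [m >= size L], so being linked at
     level [size L] in row [Y] suffices for [O X]. *)
  pose m := maxn n (size L).
  have [s [[Ns /hphi[s1 s2]] Bm]] : N `&` config (L' ++ [:: Y]) phi `&` B m !=set0.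
    apply: contrapT => h; apply: hno; exists m, N, (L' ++ [:: Y]), phi; split => // Z.
    by rewrite mem_cat => /orP[/L'D h'|]; [move=> DZ; apply: h'; left|rewrite inE => /eqP->].
  exists s; split => //; apply: hM; split => //.
    by apply: Bdec Bm; exact: leq_maxl.
  move=> X XL; split; first exact: Bdec Bm.
  move=> j Bj nBj; have mj : (m <= j)%N.
    by rewrite leqNgt; apply/negP => jm; apply: nBj; apply: Bdec Bm.
  apply: (linkedS (leq_trans (leq_maxr n _) mj)).
  exact: s2 (mem_head _ _) _ XL.
- right; split.
    move=> n; exists setT, n, [::]; split; [exact: filterT|by move=> s []].
  exists O => // X; exists setT, 0%N, [:: X]; split; [exact: filterT|].
  by move=> s [_ _ h]; apply: h; rewrite inE.
Qed.

(** * Transfinite enumeration *)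

(** The order laws are read off the least elements of sets of one, two or three points. *)
Lemma strict_well_order (T : eqType) : exists lt : T -> T -> Prop,
  [/\ well_founded lt, forall x y z, lt x y -> lt y z -> lt x z &
      forall x y, [\/ lt x y, x = y | lt y x]].
Proof.
have [R wR] := well_ordering_principle T.
have minP (A : {pred T}) x : x \in A -> exists2 z, z \in A & forall y, y \in A -> R z y.
  by move=> xA; have [|z [[zA hz] _]] := wR A; [by exists x|by exists z].
have Rxx x : R x x.
  have [z /[!inE]/eqP -> h] := minP (pred1 x) x ltac:(by rewrite inE).
  by apply: h; rewrite inE.
have anti x y : R x y -> R y x -> x = y.
  move=> xy yx; have [|z [_ hz]] := wR (pred2 x y); first by exists x; rewrite inE eqxx.
  rewrite -(hz x) ?(hz y)//; split; rewrite ?inE ?eqxx ?orbT//.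
  - by move=> w; rewrite !inE => /orP[/eqP->//|/eqP->//].
  - by move=> w; rewrite !inE => /orP[/eqP->//|/eqP->//].
exists (fun x y => ~ R y x); split.
- move=> x; apply: contrapT => nAx.
  have [|z /asboolP nAz hz] := minP [pred x | `[< ~ Acc (fun x y => ~ R y x) x >]] x.
    exact/asboolP.
  apply: nAz; constructor => y nRzy; apply: contrapT => nAy; apply: nRzy.
  by apply: hz; exact/asboolP.
- move=> x y z nyx nzy zx.
  have [m] := minP (pred3 x y z) x ltac:(by rewrite inE eqxx).
  rewrite inE => /or3P[] /eqP -> h.
  + have /(anti _ _ zx) zx' : R x z by apply: h; rewrite !inE eqxx !orbT.
    by apply: nzy; rewrite zx'; apply: h; rewrite !inE eqxx !orbT.
  + by apply: nyx; apply: h; rewrite inE eqxx.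
  + by apply: nzy; apply: h; rewrite !inE eqxx !orbT.
- move=> x y; have [xy|] := pselect (R x y); last by constructor 3.
  have [yx|] := pselect (R y x); last by constructor 1.
  by constructor 2; exact: anti.
Qed.

Lemma countable_enum (T : Type) (A : set T) (x0 : T) : countable A ->
  exists e : nat -> T, A `<=` range e.
Proof.
move=> /countable_injP[f finj].
have /choice[e he] : forall n, exists x, forall y, A y -> f y = n -> y = x.
  move=> n; have [[x [Ax fx]]|h] := pselect (exists x, A x /\ f x = n).
    by exists x => y Ay fy; apply: finj; rewrite ?inE// fx.
  by exists x0 => y Ay fy; case: h; exists y.
by exists e => x Ax; exists (f x) => //; apply/esym/he.
Qed.

Definition unpair (n : nat) : nat * nat := odflt (0, 0)%N (unpickle n).

Lemma unpairK : cancel (@pickle _) unpair.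
Proof. by move=> ij; rewrite /unpair pickleK. Qed.

(* Transfinite recursion along [V] can attach a task to every element of [T] and
   still find an unused element at each stage, although each stage uses up
   finitely many of them. This replaces a well-order of type [#|T|]: call [t]
   big when the elements below it, counted omega times, already cover [T] up to
   countably many points; [V] is omega copies of the set of non-big points. *)
Lemma long_enumeration (T : eqType) : ~ countable [set: T] ->
  exists (V : Type) (lt : V -> V -> Prop) (G : V -> T),
  [/\ well_founded lt, forall u v w, lt u v -> lt v w -> lt u w,
      forall u v, [\/ lt u v, u = v | lt v u],
      forall t, exists v, G v = t &
      forall v (H : V -> seq T) (D : seq T),
        exists t, (forall u, lt u v -> t \notin H u) /\ t \notin D].
Proof.
move=> unc; have [lt [wf trans tot]] := strict_well_order T.
have [x0 _] : [set: T] !=set0 by apply/set0P/negP => /eqP h; apply: unc; rewrite h.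
pose missed t (G : T -> nat -> T) := ~` [set x | exists r n, lt r t /\ x = G r n].
pose big t := exists G, countable (missed t G).
have [G hG] : exists G : T -> nat -> T, forall t, exists s, ~ big s /\ exists n, G s n = t.
  (* If no element is big, all of [T] serves as index set. Otherwise take the least big [t0]: the
     elements below it are not big. *)
  have [nb|/existsNP[t1 /contrapT bt1]] := pselect (forall t, ~ big t).
    by exists (fun s _ => s) => t; exists t; split => //; exists 0%N.
  have [t0 [bt0 mt0]] : exists t, big t /\ forall s, lt s t -> ~ big s.
    elim/(well_founded_ind wf): t1 bt1 => t IH bt.
    have [h|/existsNP[s /not_implyP[st /contrapT/(IH _ st)]]//] :=
      pselect (forall s, lt s t -> ~ big s).
    by exists t.
  have [G0 cG0] := bt0; have [e he] := countable_enum x0 cG0.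
  (* Even slots carry the covering by elements below [t0], odd slots the countable remainder. *)
  exists (fun s n => if odd n then e n./2 else G0 s n./2) => t.
  have [[r [n [rt0 ->]]]|/he[n _ <-]] := pselect (exists r n, lt r t0 /\ t = G0 r n).
    exists r; split; first exact: mt0.
    by exists n.*2; rewrite odd_double doubleK.
  have [r rt0] : exists r, lt r t0.
    apply: contrapT => h; apply: unc; apply: sub_countable cG0.
    by apply: subset_card_le => x _ [r [m [rt _]]]; apply: h; exists r.
  exists r; split; first exact: mt0.
  by exists (n.*2.+1); rewrite /= odd_double /= uphalf_double.
pose V := ({s | ~ big s} * nat)%type.
pose ltV (u v : V) := lt (sval u.1) (sval v.1) \/ sval u.1 = sval v.1 /\ (u.2 < v.2)%N.
exists V, ltV, (fun v => G (sval v.1) v.2); split.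
- move=> [[s bs] n]; elim/(well_founded_ind wf): s bs n => s IH bs n.
  elim/ltn_ind: n => n IHn; constructor => -[[r br] m] [/= rs|/= [rs mn]].
    exact: IH.
  by move: br; rewrite rs => br; rewrite (Prop_irrelevance br bs); exact: IHn.
- move=> [[u bu] i] [[v bv] j] [[w bw] k]; rewrite /ltV /= => -[uv|[-> ij]] [vw|[<- jk]].
  + by left; exact: trans vw.
  + by left.
  + by left.
  + by right; split => //; exact: ltn_trans jk.
- move=> [[u bu] i] [[v bv] j]; have [uv|uv|vu] := tot u v.
  + by constructor 1; left.
  + move: bv; rewrite -uv => bv; rewrite (Prop_irrelevance bv bu).
    have [ij|ji|->] := ltngtP i j; [constructor 1|constructor 3|by constructor 2];
    by right.
  + by constructor 3; left.
- move=> t; have [s [bs [n Gsn]]] := hG t.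
  by exists (exist _ s bs, n).
- move=> [[s bs] n] H D; apply: contrapT => hno; apply: (bs).
  (* If every element were used before [(s, n)], then [s] would be big: [K] lists the entries of [H]
     over elements below [s], and only [D] and the finitely many lists at [(s, m)] with [m < n] are
     left out. *)
  pose K r m := if pselect (~ big r) is left br then
    nth x0 (H (exist _ r br, (unpair m).1))
      (unpair m).2 else x0.
  exists K; apply: (@sub_countable _ _ _
     [set` D ++ flatten [seq H (exist _ s bs, m) | m <- iota 0 n]]); last first.
    by apply: finite_set_countable; exact: finite_seq.
  apply: subset_card_le => t nKt /=.
  have /not_andP[/existsNP[[[r br] m] /not_implyP[+ /negP/negPn tH]]|/negP/negPn tD] :
      ~ ((forall u, ltV u (exist _ s bs, n) -> t \notin H u) /\ t \notin D).
    by move=> h; apply: hno; exists t.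
  2: by rewrite mem_cat tD.
  move=> [/= rs|/= [rs mn]].
    case: nKt; exists r, (pickle (m, index t (H (exist _ r br, m)))); split => //.
    rewrite /K; case: pselect => // br'; rewrite unpairK /=.
    by rewrite (Prop_irrelevance br' br) nth_index.
  rewrite mem_cat; apply/orP; right; apply/flattenP; exists (H (exist _ s bs, m)).
    by apply/mapP; exists m => //; rewrite mem_iota.
  by move: br tH; rewrite rs => br; rewrite (Prop_irrelevance br bs).
Qed.

(** * Construction of the ultrafilter *)

Lemma uncountable_real : ~ countable [set: real].
Proof.
move=> /(countable_enum (fun=> true))[e he].
have [n _ /(congr1 (@^~ n))] := he (fun n => ~~ e n n) I.
by rewrite /=; case: (e n n).
Qed.

Definition decreasing (B : nat -> set node) := forall m n, (m <= n)%N -> B n `<=` B m.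

Definition settled p B F := not_image p B F /\ (decreasing B -> decided B F).

(** The invariant of the recursion. The last clause leaves infinitely many rows unspent. *)
Definition extendible (F : set_system node) (D : set real) :=
  [/\ Filter F, cofinal_nodes `<=` F, independent F D &
      forall L : seq real, exists Y, ~ D Y /\ Y \notin L].

Lemma settle p B F D : ProperFilter p -> extendible F D ->
  exists F' (L : seq real), [/\ Filter F', F `<=` F', independent F' (D `|` [set` L]) &
    settled p B F'].
Proof.
move=> pp [FF cF Find room].
have [|F1 [L1 [FF1 F01 Find1 [M F1M pM]]]] := not_image_step B pp FF cF Find.
  by have [Y [DY _]] := room [::]; exists Y.
have [Bdec|nBdec] := pselect (decreasing B); last first.
  by exists F1, L1; split => //; split => //; exists M.
have [|F2 [L2 [FF2 F12 Find2 dec2]]] := decided_step Bdec FF1 Find1.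
  by have [Y [DY /negP YL]] := room L1; exists Y => -[].
exists F2, (L1 ++ L2); split => //; first by move=> N /F01/F12.
  apply: (eq_rect _ (independent F2) Find2); apply/seteqP; split => Y /=.
    by rewrite mem_cat => -[[|->]|->]; [left|right|right; rewrite orbT].
  by rewrite mem_cat => -[|/orP[]]; [left; left|left; right|right].
by split => //; exists M => //; exact: F12.
Qed.

(** Each stage settles one sequence [B] and spends finitely many rows; the enumeration leaves fresh
    rows at every stage. The union of the stages is [q]. *)
Lemma ok_ultrafilter (p : set_system nat) : ProperFilter p ->
  exists q : set_system node,
  [/\ ProperFilter q, forall M, q M \/ q (~` M),
      forall h : nat -> node, exists2 M, q M & ~ p (h @^-1` M) &
      forall B, decreasing B -> (forall n, q (B n)) ->
        exists2 O, ok_family B O & forall X, q (O X)].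
Proof.
move=> pp.
have [V [lt [G [wf trans tot surjG long]]]] := long_enumeration uncountable_real.
(* A sequence of sets of nodes is coded by one real, its characteristic function on pairs, so [G]
   enumerates all tasks. *)
pose task v : nat -> set node := fun n s => G v (pickle (n, s)).
have task_surj B : exists v, task v = B.
  have [v Gv] := surjG (fun m => if unpickle m is Some (n, s) then `[< B n s >] else false).
  exists v; apply/funext => n; apply/funext => s; rewrite /task Gv pickleK.
  exact: asboolE.
pose state := (set_system node * set real)%type.
have /choice[step hstep] : forall vS : V * state, exists R : set_system node * seq real,
    extendible vS.2.1 vS.2.2 ->
    [/\ Filter R.1, vS.2.1 `<=` R.1, independent R.1 (vS.2.2 `|` [set` R.2]) &
      settled p (task vS.1) R.1].
  move=> [v [F D]] /=; have [ext|next] := pselect (extendible F D).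
    by have [F' [L hL]] := settle (task v) pp ext; exists (F', L).
  by exists (F, [::]).
pose pre v (rec : forall u, lt u v -> set_system node * seq real) : state :=
  ([set M | cofinal_nodes M \/ exists u (h : lt u v), (rec u h).1 M],
   [set Y | exists u (h : lt u v), Y \in (rec u h).2]).
pose stage := Fix wf (fun=> _) (fun v rec => step (v, pre v rec)).
pose before v := pre v (fun u _ => stage u).
have stageE v : stage v = step (v, before v).
  rewrite /stage Fix_eq// => u f g fg; congr (step (_, pre _ _)).
  by apply: functional_extensionality_dep => w; apply: functional_extensionality_dep => h.
have hext v : extendible (before v).1 (before v).2.
  elim/(well_founded_ind wf): v => v IH.
  have IH' u : lt u v -> [/\ Filter (stage u).1, (before u).1 `<=` (stage u).1 &
      independent (stage u).1 ((before u).2 `|` [set` (stage u).2])].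
    by move=> /IH ext; rewrite stageE; have [] := hstep (u, before u) ext.
  have cmp u w : lt u w -> (stage u).1 `<=` (before w).1.
    by move=> uw M sM; right; exists u, uw.
  split.
  - split.
    + by left; exact: (@filterT _ _ cofinal_nodes_filter).
    + have cofI M N u (uv : lt u v) : cofinal_nodes M -> (stage u).1 N -> (before v).1 (M `&` N).
        move=> cM sN; have [FF bs _] := IH' u uv.
        by right; exists u, uv; apply: filterI => //; apply: bs; left.
      move=> M N [cM|[u [uv sM]]] [cN|[w [wv sN]]].
      * by left; exact: (@filterI _ _ cofinal_nodes_filter).
      * exact: cofI cM sN.
      * by rewrite setIC; exact: cofI cN sM.
      * have [FFu bsu _] := IH' u uv; have [FFw bsw _] := IH' w wv.
        have [uw|uw|wu] := tot u w; right.
        -- exists w, wv; apply: filterI => //; apply: bsw; exact: cmp sM.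
        -- by move: sN; rewrite -uw => sN; exists u, uv; exact: filterI.
        -- exists u, uv; apply: filterI => //; apply: bsu; exact: cmp sN.
    + move=> M N MN [cM|[u [uv sM]]].
        by left; exact: (@filterS _ _ cofinal_nodes_filter) cM.
      by right; exists u, uv; have [FFu _ _] := IH' u uv; exact: filterS sM.
  - by move=> M cM; left.
  (* A set in the union is cofinite or already belongs to one earlier stage, whose independence
     applies. *)
  - move=> M [[k Mk]|[u [uv sM]]] L phi LD.
      by have [s [ks cs]] := config_unbounded L phi k; exists s; split => //; exact: Mk.
    have [_ _ ind] := IH' u uv; apply: ind sM _ _ _ => Y /LD YD [[w [wu Yw]]|Yu]; apply: YD.
      by exists w, (trans _ _ _ wu uv).
    by exists u, uv.
  - move=> L; have [Y [hY YL]] := long v (fun u => (stage u).2) L.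
    by exists Y; split => // -[u [uv]]; apply/negP; exact: hY.
have hst v : [/\ Filter (stage v).1, (before v).1 `<=` (stage v).1,
     independent (stage v).1 ((before v).2 `|` [set` (stage v).2]) &
     settled p (task v) (stage v).1].
  by rewrite stageE; exact: (hstep (v, before v) (hext v)).
have mono u v : lt u v -> (stage u).1 `<=` (stage v).1.
  by move=> uv M sM; have [_ h _ _] := hst v; apply: h; right; exists u, uv.
pose q : set_system node := [set M | exists v, (stage v).1 M].
have qset B : settled p B q.
  have [v <-] := task_surj B; have [_ _ _ [[M sM pM] dec]] := hst v.
  split; first by exists M => //; exists v.
  move=> /dec[[n sn]|[sB [O okO sO]]]; first by left; exists n, v.
  by right; split; [move=> n; exists v|exists O => // X; exists v].
have qF : Filter q.
  split.
  - have [v _] := task_surj (fun=> set0); exists v; have [FF _ _ _] := hst v; exact: filterT.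
  - move=> M N [u sM] [v sN]; have [FFu _ _ _] := hst u; have [FFv _ _ _] := hst v.
    have [uv|uv|vu] := tot u v.
    + by exists v; apply: filterI => //; exact: mono sM.
    + by exists u; apply: filterI => //; rewrite uv.
    + by exists u; apply: filterI => //; exact: mono sN.
  - by move=> M N MN [v sM]; exists v; have [FF _ _ _] := hst v; exact: filterS sM.
have q0 : ~ q set0.
  (* Independence for the empty list of rows says that members are nonempty. *)
  move=> [v sv]; have [_ _ ind _] := hst v.
  by have [|s []] := ind set0 sv [::] (fun=> [::]).
exists q; split.
- exact: Build_ProperFilter.
- move=> M; have [_ /(_ (fun _ _ _ _ => id))[[n h]|[h _]]] := qset (fun=> M); first by right.
  by left; apply: h 0%N.
- move=> h; have [[M qM pM] _] := qset (fun n => [set h n]); exists M => // hM.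
  apply: pM; apply: filterS hM => n /= hn; split; first by exists (h n).
  by move=> s ->.
- move=> B Bdec qB; have [_ /(_ Bdec)[[n qn]|[_ //]]] := qset B.
  by exfalso; apply: q0; rewrite -(setICr (B n)); exact: filterI (qB n) qn.
Qed.

(** * Separation in compact F-spaces *)

(** Iterated normality gives open sets [W n] with closure inside [W n.+1], so their union is also
    the union of their closures. *)
Lemma open_Fsigma_between (X : topologicalType) (A U : set X) :
  hausdorff_space X -> compact [set: X] -> closed A -> open U -> A `<=` U ->
  exists O, [/\ open O, Fsigma O, A `<=` O & O `<=` U].
Proof.
move=> hX cX clA oU AU.
have /choice[nxt hnxt] : forall C : set X, exists V, closed C -> C `<=` U ->
    [/\ open V, C `<=` V & closure V `<=` U].
  move=> C; have [[clC CU]|h] := pselect (closed C /\ C `<=` U); last first.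
    by exists set0 => c1 c2; case: h.
  have [|B /set_nbhsP[V [oV CV VB]] BU] := compact_normal hX cX clC (A := C) (t := U).
    by apply/set_nbhsP; exists U; split.
  by exists V => _ _; split => //; apply: subset_trans BU; exact: closureS.
pose W := fix W n := if n is m.+1 then nxt (closure (W m)) else nxt A.
have hW n : [/\ open (W n), A `<=` W n & closure (W n) `<=` U].
  elim: n => [|n [oW AW WU]]; first exact: hnxt.
  have [o1 s1 s2] := hnxt _ (@closed_closure _ (W n)) WU.
  by split => //; apply: subset_trans s1; apply: subset_trans AW _; exact: subset_closure.
exists (\bigcup_n W n); split.
- by apply: bigcup_open => n _; have [] := hW n.
- exists (fun n => closure (W n)); first by move=> n; exact: closed_closure.
  apply/seteqP; split => [x [n _ Wx]|x [n _ Wx]].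
    by exists n => //; exact: subset_closure.
  exists n.+1 => //; have [_ _ WU] := hW n.
  by have [_ s1 _] := hnxt _ (@closed_closure _ (W n)) WU; exact: s1.
- by have [_ AW _] := hW 0%N; move=> x Ax; exists 0%N => //; exact: AW.
- by move=> x [n _ Wx]; have [_ _] := hW n; apply; exact: subset_closure.
Qed.

Lemma disjoint_closed_open_Fsigma (X : topologicalType) (A B : set X) :
  hausdorff_space X -> compact [set: X] -> closed A -> closed B -> A `&` B = set0 ->
  exists O P, [/\ open O /\ Fsigma O, open P /\ Fsigma P, A `<=` O, B `<=` P &
    O `&` P = set0].
Proof.
move=> hX cX clA clB AB.
have AnB : A `<=` ~` B by apply/disjoints_subset.
have [|V /set_nbhsP[W [oW AW WV]] VB] :=
    compact_normal hX cX clA (A := A) (t := ~` B).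
  by apply/set_nbhsP; exists (~` B); split => //; exact: closed_openC.
have [O [oO fO AO OW]] := open_Fsigma_between hX cX clA oW AW.
have [||P [oP fP BP PV]] := open_Fsigma_between (U := ~` closure V) hX cX clB.
  exact/closed_openC/closed_closure.
  by move=> x Bx Vx; exact: VB Bx.
exists O, P; split => //; apply/disjoints_subset => x /OW/WV Vx /PV; apply.
exact: subset_closure.
Qed.

Lemma FsigmaI (X : topologicalType) (A B : set X) : Fsigma A -> Fsigma B -> Fsigma (A `&` B).
Proof.
move=> [F clF ->] [G clG ->].
exists (fun n => F (unpair n).1 `&`
                 G (unpair n).2).
  by move=> n; exact: closedI.
apply/seteqP; split => [x [[i _ Fx] [j _ Gx]]|x [n _ [Fx Gx]]].
  by exists (pickle (i, j)) => //; rewrite unpairK.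
by split; eexists; eauto.
Qed.

Lemma Fsigma_bigcup (X : topologicalType) (A : nat -> set X) :
  (forall n, Fsigma (A n)) -> Fsigma (\bigcup_n A n).
Proof.
move=> hA; have /choice[F hF] : forall n, exists F : nat -> set X,
    (forall i, closed (F i)) /\ A n = \bigcup_i F i.
  by move=> n; have [F c e] := hA n; exists F.
exists (fun n => F (unpair n).1
                   (unpair n).2).
  by move=> n; case: (hF (unpair n).1).
apply/seteqP; split => [x [n _]|x [n _ Fx]].
  have [_ ->] := hF n => -[i _ Fx]; exists (pickle (n, i)) => //.
  by rewrite unpairK.
exists (unpair n).1 => //.
by have [_ ->] := hF (unpair n).1; eexists; eauto.
Qed.

Lemma open_Fsigma_bigcap (X : topologicalType) (A : nat -> set X) n :
  (forall n, open (A n) /\ Fsigma (A n)) ->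
  open (\bigcap_(m in `I_n) A m) /\ Fsigma (\bigcap_(m in `I_n) A m).
Proof.
move=> hA; elim: n => [|n [oI fI]].
  rewrite II0 bigcap_set0; split; first exact: openT.
  exact: (closed_Fsigma closedT).
rewrite IIS bigcap_setU bigcap_set1; have [oA fA] := hA n.
by split; [exact: openI|exact: FsigmaI].
Qed.

(** Each point of one set has a neighborhood missing an open set around the closure of the other.
    Trimmed by finitely many of the opposite open sets, these neighborhoods have disjoint open
    F-sigma unions, to which the F-space property applies. *)
Lemma separated_closure (X : topologicalType) (A B : set X) :
  hausdorff_space X -> compact [set: X] -> F_space X ->
  countable A -> countable B ->
  A `&` closure B = set0 -> closure A `&` B = set0 -> closure A `&` closure B = set0.
Proof.
move=> hX cX FX cA cB AB BA.
have [A0|/set0P[x0 _]] := eqVneq A set0; first by rewrite A0 closure0 set0I.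
have fam (C D : set X) : countable C -> C `&` closure D = set0 ->
  exists e (U P : nat -> set X), C `<=` range e /\ forall n,
    [/\ open (U n) /\ Fsigma (U n), open (P n) /\ Fsigma (P n),
      C (e n) -> U n (e n), closure D `<=` P n & U n `&` P n = set0].
  move=> cC CD; have [e he] := countable_enum x0 cC.
  have /choice[UP hUP] : forall n, exists UP : set X * set X,
      [/\ open UP.1 /\ Fsigma UP.1, open UP.2 /\ Fsigma UP.2, C (e n) -> UP.1 (e n),
       closure D `<=` UP.2 & UP.1 `&` UP.2 = set0].
    move=> n; have [Ce|nCe] := pselect (C (e n)); last first.
      exists (set0, setT); split => //=; last by rewrite set0I.
        by split; [exact: open0|exact: (closed_Fsigma closed0)].
      by split; [exact: openT|exact: (closed_Fsigma closedT)].
    have [|||O [P [hO hP eO DP OP]]] :=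
        @disjoint_closed_open_Fsigma X [set e n] (closure D) hX cX.
    - exact/accessible_closed_set1/hausdorff_accessible.
    - exact: closed_closure.
    - apply/disjoints_subset => _ -> De.
      by suff : set0 (e n) by []; rewrite -CD.
    - by exists (O, P); split => // _; exact: eO.
  by exists e, (fun n => (UP n).1), (fun n => (UP n).2).
have [a [U [P [Aa hU]]]] := fam A B cA AB.
have [b [V [Q [Bb hV]]]] := fam B A cB ltac:(by rewrite setIC).
(* Of two trimmed neighborhoods, the one with the larger index lies in an open set missing the
   other. The bound [n.+1] covers equal indices. *)
pose UU n := U n `&` \bigcap_(m in `I_n.+1) Q m.
pose VV n := V n `&` \bigcap_(m in `I_n.+1) P m.
have oUU n : open (UU n) /\ Fsigma (UU n).
  have [[oU fU] _ _ _ _] := hU n.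
  have [|oQ fQ] := @open_Fsigma_bigcap X Q n.+1; first by move=> m; have [] := hV m.
  by split; [exact: openI|exact: FsigmaI].
have oVV n : open (VV n) /\ Fsigma (VV n).
  have [[oV fV] _ _ _ _] := hV n.
  have [|oP fP] := @open_Fsigma_bigcap X P n.+1; first by move=> m; have [] := hU m.
  by split; [exact: openI|exact: FsigmaI].
have : closure (\bigcup_n UU n) `&` closure (\bigcup_n VV n) = set0.
  apply: FX.
  - by apply: bigcup_open => n _; have [] := oUU n.
  - by apply: Fsigma_bigcup => n; have [] := oUU n.
  - by apply: bigcup_open => n _; have [] := oVV n.
  - by apply: Fsigma_bigcup => n; have [] := oVV n.
  - apply/disjoints_subset => x [n _ [Ux Qx]] [m _ [Vx Px]].
    have [nm|mn] := leqP n m.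
      have [_ _ _ _ UP] := hU n; suff : set0 x by [].
      by rewrite -UP; split => //; exact: Px.
    have [_ _ _ _ VQ] := hV m; suff : set0 x by [].
    by rewrite -VQ; split => //; apply: Qx; exact: ltnW.
move=> dis; apply/disjoints_subset => x Ax Bx; suff : set0 x by [].
rewrite -dis; split.
- apply: closureS Ax => y Ay; have [n _ ny] := Aa y Ay; exists n => //.
  have [_ _ Ue _ _] := hU n; split; first by rewrite -ny; apply: Ue; rewrite ny.
  by move=> m _; have [_ _ _ AQ _] := hV m; apply: AQ; exact: subset_closure.
- apply: closureS Bx => y By; have [n _ ny] := Bb y By; exists n => //.
  have [_ _ Ve _ _] := hV n; split; first by rewrite -ny; apply: Ve; rewrite ny.
  by move=> m _; have [_ _ _ BP _] := hU m; apply: BP; exact: subset_closure.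
Qed.

(** * Limits of discrete sequences *)

(** The recursion keeps an infinite open set and splits off a point with an open neighborhood, so
    that a disjoint infinite open subset remains. *)
Lemma discrete_sequence (X : topologicalType) :
  hausdorff_space X -> infinite_set [set: X] ->
  exists (d : nat -> X) (U : nat -> set X),
    [/\ forall n, open (U n), forall n, U n (d n) &
        forall m n x, U m x -> U n x -> m = n].
Proof.
move=> hX infX.
have /choice[nxt hnxt] : forall O : set X, exists R : X * set X * set X,
    open O /\ infinite_set O -> [/\ open R.1.2, R.1.2 R.1.1, R.1.2 `<=` O,
      open R.2 /\ infinite_set R.2 & R.2 `<=` O /\ R.1.2 `&` R.2 = set0].
  move=> O; have [[oO iO]|h] := pselect (open O /\ infinite_set O); last first.
    have [x _] : [set: X] !=set0 by apply/set0P/eqP => h0; apply: infX; rewrite h0.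
    by exists (x, set0, set0) => h'; case: h.
  have [x Ox] : O !=set0 by apply/set0P/eqP => h0; apply: iO; rewrite h0.
  have [y [Oy /eqP xy]] : exists y, O y /\ y <> x.
    apply: contrapT => h; apply: iO; apply: (sub_finite_set (B := [set x])) => // y Oy.
    by apply: contrapT => yx; apply: h; exists y.
  have [[A B] /= [/set_mem yA /set_mem xB] [oA oB AB]] : exists2 AB : set X * set X,
      y \in AB.1 /\ x \in AB.2 & [/\ open AB.1, open AB.2 & AB.1 `&` AB.2 == set0].
    by move: hX; rewrite open_hausdorff => /(_ _ _ xy)[AB h1 h2]; exists AB.
  move/eqP in AB.
  (* A finite neighborhood of [x] can be removed, as finite sets are closed; an infinite one is
     kept, and [y] is split off instead. *)
  have [fin|inf] := pselect (finite_set (O `&` B)).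
    exists (x, O `&` B, O `&` ~` (O `&` B)) => _ /=; split.
    - exact: openI.
    - by [].
    - by move=> z [].
    - split.
        apply: openI => //; apply: closed_openC.
        by have /accessible_finite_set_closed := hausdorff_accessible hX; apply.
      move=> fin'; apply: iO.
      have : finite_set (O `&` B `|` O `&` ~` (O `&` B)) by rewrite finite_setU.
      apply: sub_finite_set => z Oz.
      by have [Bz|nBz] := pselect ((O `&` B) z); [left|right].
    - split; first by move=> z [].
      by apply/disjoints_subset => z Bz [].
  exists (y, O `&` A, O `&` B) => _ /=; split.
  - exact: openI.
  - by [].
  - by move=> z [].
  - by split; [exact: openI|].
  - split; first by move=> z [].
    by rewrite setIACA AB setI0.
pose O := fix O n := if n is m.+1 then (nxt (O m)).2 else setT.
have hO n : open (O n) /\ infinite_set (O n).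
  elim: n => [|n IH]; first by split => //; exact: openT.
  by have [_ _ _] := hnxt _ IH.
have Odec m n : (m <= n)%N -> O n `<=` O m.
  move=> /subnK <-; elim: (n - m)%N => // k IH x /= Ox; apply: IH.
  by have [_ _ _ _ [h _]] := hnxt _ (hO (k + m)%N); exact: h.
have dis m n x : (m < n)%N -> (nxt (O m)).1.2 x -> (nxt (O n)).1.2 x -> False.
  move=> mn Ux Vx; have [_ _ _ _ [_ h]] := hnxt _ (hO m).
  have [_ _ h' _ _] := hnxt _ (hO n).
  by suff : set0 x by []; rewrite -h; split => //; apply: (Odec m.+1 n mn); exact: h'.
exists (fun n => (nxt (O n)).1.1), (fun n => (nxt (O n)).1.2); split.
- by move=> n; have [] := hnxt _ (hO n).
- by move=> n; have [] := hnxt _ (hO n).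
- move=> m n x Ux Vx; have [mn|nm|//] := ltngtP m n.
    by case: (dis m n x).
  by case: (dis n m x).
Qed.

(** A cluster point of the image filter; along an ultrafilter this is the limit. *)
Lemma compact_limit (X : topologicalType) (T : Type) (p : set_system T) (d : T -> X) :
  compact [set: X] -> ProperFilter p ->
  exists a, forall N, p N -> closure (d @` N) a.
Proof.
move=> cX pp; have pf : ProperFilter (fmap d p) by exact: fmap_proper_filter.
have [a [_ ha]] := cX _ pf (filterT (F := fmap d p)).
exists a => N pN B aB; apply: ha aB.
by apply: (filterS (F := p)) pN => n Nn; exists n.
Qed.

Lemma ultra_limit_unique (X : topologicalType) (T : Type) (p : set_system T)
    (d : T -> X) (a b : X) :
  hausdorff_space X -> ProperFilter p -> (forall N, p N \/ p (~` N)) ->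
  (forall N, p N -> closure (d @` N) a) -> (forall N, p N -> closure (d @` N) b) -> a = b.
Proof.
move=> hX pp pu ha hb; apply: hX => A B aA bB.
have near c C : (forall N, p N -> closure (d @` N) c) -> nbhs c C -> p (d @^-1` C).
  move=> hc cC; have [//|/hc h] := pu (d @^-1` C).
  by have [_ [[n nC <-]]] := h C cC.
have [n [An Bn]] := filter_ex (filterI (near _ _ ha aA) (near _ _ hb bB)).
by exists (d n).
Qed.

(** The sets [U s] separate the images of disjoint index sets, so the closures of these images are
    disjoint. This is applied to [N] and to [M] without [N]. *)
Lemma discrete_closureI (X : topologicalType) (S : countType) (d : S -> X) (U : S -> set X) :
  hausdorff_space X -> compact [set: X] -> F_space X ->
  (forall s, open (U s)) -> (forall s, U s (d s)) ->
  (forall s t x, U s x -> U t x -> s = t) ->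
  forall M N, closure (d @` M) `&` closure (d @` N) `<=` closure (d @` (M `&` N)).
Proof.
move=> hX cX FX oU Ud disU M N x [xM xN].
have far M1 N1 : M1 `&` N1 = set0 -> d @` M1 `&` closure (d @` N1) = set0.
  move=> MN; apply/disjoints_subset => _ [s Ms <-] /(_ (U s))[].
    by apply: open_nbhs_nbhs; split.
  move=> _ [[t Nt <-] Ut]; suff : set0 s by [].
  by rewrite -MN; split => //; rewrite (disU _ _ _ (Ud t) Ut) in Nt *.
have dis M1 N1 : M1 `&` N1 = set0 -> closure (d @` M1) `&` closure (d @` N1) = set0.
  move=> MN; apply: separated_closure => //.
  - exact: sub_countable (card_image_le _ _) (countableP _).
  - exact: sub_countable (card_image_le _ _) (countableP _).
  - exact: far.
  - by rewrite setIC; apply: far; rewrite setIC.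
have : closure (d @` (M `&` N) `|` d @` (M `&` ~` N)) x.
  apply: closureS xM => _ [s Ms <-].
  by have [Ns|nNs] := pselect (N s); [left|right]; exists s.
rewrite closureU => -[//|xMN]; suff : set0 x by [].
by rewrite -(dis (M `&` ~` N) N) // -setIA setICl setI0.
Qed.

(** * Sequences accumulating at a limit along q *)

Lemma uncountable_fiber (f : real -> nat) : exists n, infinite_set (f @^-1` [set n]).
Proof.
apply: contrapT => h; apply: uncountable_real.
have -> : [set: real] = \bigcup_n (f @^-1` [set n]).
  by apply/seteqP; split => // X _; exists (f X).
apply: bigcup_countable => // n _; apply: finite_set_countable; apply: contrapT => hn.
by apply: h; exists n.
Qed.

(** Otherwise [p]-almost all [x n] lie outside the remainder. If almost none is in any [U s], they
    are separated from the range of [d]. If almost all are in [U (h n)], take [M] in [q] with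
    preimage under [h] not in [p]: the [x n] with [h n] outside [M] are separated from the image of
    [M]. Both contradict the common limit [a]. *)
Lemma not_pushed_limit_in_remainder (X : topologicalType) (d : node -> X) (U : node -> set X)
    (p : set_system nat) (q : set_system node) (x : nat -> X) (a : X) :
  hausdorff_space X -> compact [set: X] -> F_space X ->
  (forall s, open (U s)) -> (forall s, U s (d s)) ->
  (forall s t y, U s y -> U t y -> s = t) ->
  (forall M, q M -> closure (d @` M) a) -> (forall N, p N -> closure (x @` N) a) ->
  ProperFilter p -> (forall N, p N \/ p (~` N)) -> ProperFilter q ->
  (forall h : nat -> node, exists2 M, q M & ~ p (h @^-1` M)) ->
  p [set n | closure (range d) (x n) /\ ~ range d (x n)].
Proof.
move=> hX cX FX oU Ud disU qa pa pp pu qq noimg.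
set P := (X in p X); have [//|pQ] := pu P.
have sep N M : p N -> q M -> x @` N `&` closure (d @` M) = set0 ->
    closure (x @` N) `&` d @` M = set0 -> False.
  move=> pN qM h1 h2; suff : set0 a by [].
  have <- : closure (x @` N) `&` closure (d @` M) = set0.
    apply: separated_closure => //; exact: sub_countable (card_image_le _ _) (countableP _).
  by split; [exact: pa|exact: qa].
pose C := [set n | exists s, U s (x n)].
have notD n s : (~` P) n -> U s (x n) -> closure (range d) (x n) -> x n = d s.
  move=> nP Us cl; apply: contrapT => xs; apply: nP; split => // -[t _ dt].
  by apply: xs; rewrite -dt (disU s t (x n) Us)// -dt.
have [pC|pC] := pu C; last first.
  exfalso; apply: (sep (~` P `&` ~` C) setT); [exact: filterI|exact: filterT| |].
    apply/disjoints_subset => _ [n [nP nC] <-] cl; apply: nP; split => // -[s _ ds].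
    by apply: nC; exists s; rewrite -ds.
  rewrite setIC; apply/disjoints_subset => _ [s _ <-] /(_ (U s))[].
    by apply: open_nbhs_nbhs; split.
  by move=> _ [[n [_ nC] <-] Us]; apply: nC; exists s.
have /choice[h hh] : forall n, exists s, C n -> U s (x n).
  move=> n; have [[s Us]|nC] := pselect (C n); first by exists s.
  by exists (@mk_node 0 [ffun=> finset.set0]).
have [M qM pM] := noimg h; have {pM}pM : p (~` (h @^-1` M)) by case: (pu (h @^-1` M)).
exfalso; apply: (sep (~` P `&` C `&` ~` (h @^-1` M)) M) => //.
- by apply: filterI => //; exact: filterI.
- apply/disjoints_subset => _ [n [[nP nC] nM] <-] cl; apply: nM.
  have xd : x n = d (h n).
    by apply: notD => //; [exact: hh|apply: closureS cl => _ [s _ <-]; exists s].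
  have [|_ [[t Mt <-] Ut]] := cl (U (h n)).
    by apply: open_nbhs_nbhs; split; [|rewrite xd].
  by rewrite /= (disU _ _ _ Ut (Ud t)).
- rewrite setIC; apply/disjoints_subset => _ [s Ms <-] /(_ (U s))[].
    by apply: open_nbhs_nbhs; split.
  move=> _ [[n [[_ nC] nM] <-] Us]; apply: nM.
  by rewrite /= -(disU _ _ _ Us (hh n nC)).
Qed.

Lemma ok_limit_not_in_remainder (X : topologicalType) (d : node -> X) (U : node -> set X)
    (p : set_system nat) (q : set_system node) (x : nat -> X) (a : X) :
  hausdorff_space X -> compact [set: X] -> F_space X ->
  (forall s, open (U s)) -> (forall s, U s (d s)) ->
  (forall s t y, U s y -> U t y -> s = t) ->
  (forall M, q M -> closure (d @` M) a) -> (forall N, p N -> closure (x @` N) a) ->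
  ProperFilter p -> (forall N, p N \/ p (~` N)) ->
  ProperFilter q -> (forall M, q M \/ q (~` M)) ->
  (forall B, decreasing B -> (forall n, q (B n)) ->
        exists2 O, ok_family B O & forall X, q (O X)) ->
  (forall n, x n <> a) ->
  p [set n | closure (range d) (x n) /\ ~ range d (x n)] -> False.
Proof.
move=> hX cX FX oU Ud disU qa pa pp pu qq qu qok xa pP.
have clI := discrete_closureI hX cX FX oU Ud disU.
(* Otherwise [p]-almost all [x n], and hence [a], would lie in the closure of the image of the
   complement of [M]. *)
have seen M : q M -> exists n, (closure (range d) (x n) /\ ~ range d (x n)) /\
    closure (d @` M) (x n).
  move=> qM; apply: contrapT => hno.
  have pN : p [set n | closure (d @` ~` M) (x n)].
    apply: filterS pP => n [cl nd]; have : closure (d @` M `|` d @` ~` M) (x n).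
      apply: closureS cl => _ [s _ <-].
      by have [Ms|nMs] := pselect (M s); [left|right]; exists s.
    by rewrite closureU => -[cM|//]; case: hno; exists n.
  have : closure (d @` ~` M) a.
    have /closure_id -> := @closed_closure _ (d @` ~` M).
    by apply: closureS (pa _ pN) => _ [n cl <-].
  by move=> /(conj (qa _ qM))/clI; rewrite setICr image_set0 closure0.
have /choice[C hC] : forall n, exists C, q C /\ ~ closure (d @` C) (x n).
  move=> n; have /eqP xna := xa n.
  have [[A B] /= [/set_mem xA /set_mem aB] [oA oB AB]] : exists2 AB : set X * set X,
      x n \in AB.1 /\ a \in AB.2 & [/\ open AB.1, open AB.2 & AB.1 `&` AB.2 == set0].
    by move: hX; rewrite open_hausdorff => /(_ _ _ xna)[AB h1 h2]; exists AB.
  exists (d @^-1` B); split.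
    have [//|/qa/(_ B)[]] := qu (d @^-1` B); first by apply: open_nbhs_nbhs; split.
    by move=> _ [[s nB <-]].
  move=> /(_ A)[]; first by apply: open_nbhs_nbhs; split.
  move=> _ [[s Bs <-] As]; suff : set0 (d s) by [].
  by rewrite -(eqP AB).
pose B n := \bigcap_(i in `I_n.+1) C i.
have qB n : q (B n).
  rewrite /B; elim: n => [|n IH]; rewrite IIS bigcap_setU bigcap_set1.
    by rewrite II0 bigcap_set0 setTI; case: (hC 0%N).
  by apply: filterI => //; case: (hC n.+1).
have Bdec : decreasing B.
  by move=> m n mn s Bs i im; apply: Bs; exact: leq_trans im _.
have [O okO qO] := qok B Bdec qB.
(* Every OK set has some [x n] in the closure of its image. One index [n] serves infinitely many of
   them, and more than [n] are selected. *)
have /choice[nu hnu] : forall Z : real, exists n, (closure (range d) (x n) /\ ~ range d (x n)) /\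
    closure (d @` O Z) (x n) by move=> Z; exact: seen.
have [n nun] := uncountable_fiber nu.
have [L [uL Lsub Ln]] : exists L : seq real,
    [/\ uniq L, forall Z, Z \in L -> nu Z = n & (n < size L)%N].
  have [L Lsub Ln] := infinite_set_fset n.+1 nun.
  by exists (finmap.enum_fset L); split => //; exact: finmap.fset_uniq.
have [k0 hk0] := okO L uL (leq_trans (ltn0Sn n) Ln).
have [clD nD] : closure (range d) (x n) /\ ~ range d (x n).
  have [Z ZL] : exists Z, Z \in L.
    by case: (L) Ln => // Z s _; exists Z; exact: mem_head.
  by have <- : nu Z = n; [exact: Lsub|case: (hnu Z)].
have clL (L' : seq real) : {subset L' <= L} ->
    closure (d @` [set s | forall Z, Z \in L' -> O Z s]) (x n).
  elim: L' => [_|Z L' IH sub].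
    by apply: closureS clD => _ [s _ <-]; exists s.
  have : closure (d @` (O Z `&` [set s | forall Z, Z \in L' -> O Z s])) (x n).
    apply: clI; split.
      by have <- : nu Z = n; [apply: Lsub; exact: sub _ (mem_head _ _)|case: (hnu Z)].
    by apply: IH => W WL; apply: sub; rewrite inE WL orbT.
  apply: closureS => _ [s [Os hs] <-]; exists s => // W.
  by rewrite inE => /orP[/eqP ->//|]; exact: hs.
(* The selected OK sets meet inside [B (size L)], hence inside [C n], up to finitely many nodes;
   that finite part would make [x n] a term of [d]. *)
have : closure (d @` B (size L) `|` d @` [set s : node | (tag s < k0)%N]) (x n).
  apply: closureS (clL L (fun _ => id)) => _ [s hs <-].
  by have [Bs|nBs] := pselect (B (size L) s); [left|right]; exists s => //; exact: hk0.
rewrite closureU => -[cB|].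
  have [_] := hC n; apply; apply: closureS cB => _ [s Bs <-]; exists s => //.
  by apply: Bs => /=; apply: leq_trans Ln _.
have /closure_id <- : closed (d @` [set s : node | (tag s < k0)%N]).
  have /accessible_finite_set_closed := hausdorff_accessible hX; apply.
  exact/finite_image/finite_small_nodes.
by move=> [s _ ds]; apply: nD; exists s.
Qed.

(** * Two points that are not pin equivalent *)

Theorem theorem4p4 (X : topologicalType)
    (hausX : hausdorff_space X) (compX : compact [set: X])
    (infX : infinite_set [set: X]) (FX : F_space X) :
  exists a b : X, ~ pin_equivalent a b.
Proof.
have [d [U [oU Ud disU]]] := discrete_sequence hausX infX.
have [p [up sp]] := ultraFilterLemma eventually_filter.
have pu N : p N \/ p (~` N) := in_ultra_setVsetC N up.
have [q [qq qu noimg qok]] := ok_ultrafilter (@ultra_proper _ _ up).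
(* The nodes index a subsequence of [d] through their codes. *)
have [a ha] := compact_limit (d \o pickle) compX qq.
have [b hb] := compact_limit d compX (@ultra_proper _ _ up).
have pp := @ultra_proper _ _ up.
have bd n : d n <> b.
  move=> dnb; have pn : p [set m | (n < m)%N] by apply: sp; exists n.+1.
  have nU : nbhs b (U n) by apply: open_nbhs_nbhs; split; [|rewrite -dnb].
  have [_ [[m nm <-] Um]] := hb _ pn (U n) nU.
  by move: nm; rewrite /= (disU _ _ _ (Ud m) Um) ltnn.
exists b, a => -[Y [f [g [hY cY [cf sf] [cg [h [hg gh _]]] gab]]]].
(* Lift [d] to [Y]. The limit [z] of the lift along [p] lies over [b], so [g z] lies over [a], and
   the points [f (g (y n))] accumulate at [a] along [p]. *)
have /choice[y hy] : forall n, exists y, f y = d n.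
  by move=> n; have [y _ fy] := sf (d n) I; exists y.
have [z hz] := compact_limit y cY pp.
have push (k : Y -> X) N : continuous k -> closure (y @` N) z ->
    closure ((k \o y) @` N) (k z).
  move=> ck cl B kB; have [_ [[n Nn <-] By]] := cl _ (ck z B kB).
  by exists (k (y n)); split => //; exists n.
have fz : f z = b.
  apply: (ultra_limit_unique hausX pp pu (d := d)) => // N pN.
  have := push f N cf (hz N pN); congr (closure _ _).
  by apply/seteqP; split => _ [n Nn <-]; exists n => //=; rewrite hy.
have fgz : f (g z) = a by have : (f @^-1` [set a]) (g z) by rewrite -gab; exists z.
(* As [g] is injective, [g (y n)] over [a] would put [y n] over [b], forcing [d n = b]. *)
have xa n : f (g (y n)) <> a.
  move=> fgy; have : (g @` (f @^-1` [set b])) (g (y n)) by rewrite gab.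
  move=> [w fw /(congr1 h)]; rewrite !hg => wy.
  by apply: (bd n); rewrite -hy -wy.
have hx N : p N -> closure ((f \o g \o y) @` N) a.
  move=> pN; rewrite -fgz; apply: (push (f \o g)); last exact: hz.
  by move=> w; apply: continuous_comp; [exact: cg|exact: cf].
have disU' (s t : node) w : U (pickle s) w -> U (pickle t) w -> s = t.
  by move=> Us Ut; apply: (pcan_inj pickleK); exact: disU Us Ut.
apply: (ok_limit_not_in_remainder hausX compX FX (fun s => oU (pickle s))
  (fun s => Ud (pickle s)) disU' ha hx pp pu qq qu qok xa).
exact: (not_pushed_limit_in_remainder hausX compX FX (fun s => oU (pickle s))
  (fun s => Ud (pickle s)) disU' ha hx pp pu qq noimg).
Qed.
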